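(* Let $\mathcal{K}_0\subseteq\mathbb{R}^{n_1}$ and $\mathcal{K}_i\subseteq\mathbb{R}^{n_2}$, $i\in[1:S]$, be closed convex cones and $\bar{\mathcal{K}}:=(\mathcal{K}_0,\dots,\mathcal{K}_S)$. If each $\mathcal{K}_i$, $i\in[1:S]$, contains the origin, then $\mathcal{CPS}(\bar{\mathcal{K}})\subseteq\mathcal{CMP}(\bar{\mathcal{K}})$.
   Context: Notation: $[1:S]=\{1,\dots,S\}$. For a closed convex cone $\mathcal{K}\subseteq\mathbb{R}^m$ the set-completely positive cone is $\mathcal{CPP}(\mathcal{K}):=\{\sum_{l=1}^{p}x_lx_l^{\mathsf T} : x_l\in\mathcal{K},\ p\in\mathbb{N}\}$. $[M_i]_{i\in[1:S]}$ denotes an $S$-tuple of symmetric $(n_1+n_2)\times(n_1+n_2)$ matrices $M_i=\begin{pmatrix}X&Z_i^{\mathsf T}\\ Z_i&Y_i\end{pmatrix}$ sharing the same upper-left $n_1\times n_1$ block $X$; such tuples form a vector space $\mathcal{S}^{S,n_1}_{n_1+n_2}$ with componentwise operations. In this space, $$\mathcal{CMP}(\bar{\mathcal{K}}):=\operatorname{conv}\left\{\left[\begin{pmatrix}x\\ y_i\end{pmatrix}\begin{pmatrix}x\\ y_i\end{pmatrix}^{\mathsf T}\right]_{i\in[1:S]} : x\in\mathcal{K}_0,\ y_i\in\mathcal{K}_i,\ i\in[1:S]\right\},$$ $$\mathcal{CPS}(\bar{\mathcal{K}}):=\left\{\left[\begin{pmatrix}X&Z_i^{\mathsf T}\\ Z_i&Y_i\end{pmatrix}\right]_{i\in[1:S]}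 : \exists\, W_1,\dots,W_S:\ \begin{pmatrix}W_i&Z_i^{\mathsf T}\\ Z_i&Y_i\end{pmatrix}\in\mathcal{CPP}(\mathcal{K}_0\times\mathcal{K}_i),\ i\in[1:S],\ \sum_{i=1}^SW_i=X\right\}.$$ *)

(* Defs.v *)
From HB Require Import structures.
From mathcomp Require Import all_boot all_order all_algebra.
From mathcomp Require Import all_classical all_reals all_analysis.
Set Implicit Arguments.
Unset Strict Implicit.
Unset Printing Implicit Defensive.
Import Order.TTheory GRing.Theory Num.Theory.
Import numFieldNormedType.Exports.
Local Open Scope classical_set_scope.
Local Open Scope ring_scope.

(* A cone is a nonempty set stable under positive scaling; the origin is not
   required, although closedness puts it in every closed cone. *)
Definition cone (R : realType) (m : nat) (K : set 'cV[R]_m) : Prop :=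
  K !=set0 /\ forall (t : R) x, 0 < t -> K x -> K (t *: x).

Definition closed_convex_cone (R : realType) (m : nat) (K : set 'cV[R]_m)
    : Prop :=
  [/\ closed K, convex_set (K : set (convex_lmodType 'cV[R]_m)) & cone K].

Definition cone_prod (R : realType) (n1 n2 : nat)
    (K : set 'cV[R]_n1) (L : set 'cV[R]_n2) : set 'cV[R]_(n1 + n2) :=
  [set col_mx x y | x in K & y in L].

Definition conv_hull (R : realType) (V : lmodType R) (A : set V) : set V :=
  smallest (fun C : set V => convex_set (C : set (convex_lmodType V))) A.

(* The empty sum p = 0 is allowed. *)
Definition CPP (R : realType) (m : nat) (K : set 'cV[R]_m) : set 'M[R]_m :=
  [set M | exists (p : nat) (x : 'I_p -> 'cV[R]_m),
     (forall l, K (x l)) /\ M = \sum_(l < p) x l *m (x l)^T].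

(* Tuples [M_i]_i are finite functions on 'I_S, whose lmodType structure is
   componentwise; the tuples of symmetric matrices with a common upper-left
   block form the following subspace. Both CMP and CPS lie inside it
   (CMP_shared, CPS_shared), and taking the convex hull in the ambient space is
   the same as taking it in the subspace. *)
Definition shared_block_tuples (R : realType) (n1 n2 S : nat)
    : set {ffun 'I_S -> 'M[R]_(n1 + n2)} :=
  [set M | (forall i, (M i)^T = M i) /\
           (exists X : 'M[R]_n1, forall i, ulsubmx (M i) = X)].

Definition CMP (R : realType) (n1 n2 S : nat) (K0 : set 'cV[R]_n1)
    (K : 'I_S -> set 'cV[R]_n2) : set {ffun 'I_S -> 'M[R]_(n1 + n2)} :=
  conv_hull [set M | exists (x : 'cV[R]_n1) (y : 'I_S -> 'cV[R]_n2),
    [/\ K0 x, forall i, K i (y i)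
      & M = [ffun i => col_mx x (y i) *m (col_mx x (y i))^T]]].

Definition CPS (R : realType) (n1 n2 S : nat) (K0 : set 'cV[R]_n1)
    (K : 'I_S -> set 'cV[R]_n2) : set {ffun 'I_S -> 'M[R]_(n1 + n2)} :=
  [set M | exists (X : 'M[R]_n1) (Z : 'I_S -> 'M[R]_(n2, n1))
                  (Y : 'I_S -> 'M[R]_n2),
    M = [ffun i => block_mx X (Z i)^T (Z i) (Y i)] /\
    exists W : 'I_S -> 'M[R]_n1,
      (forall i, CPP (cone_prod K0 (K i))
                     (block_mx (W i) (Z i)^T (Z i) (Y i))) /\
      \sum_(i < S) W i = X].

Lemma CPP_sym (R : realType) (m : nat) (K : set 'cV[R]_m) (M : 'M[R]_m) :
  CPP K M -> M^T = M.
Proof.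
move=> [p [x [_ ->]]]; rewrite raddf_sum; apply: eq_bigr => l _ /=.
by rewrite trmx_mul trmxK.
Qed.

Lemma CPS_shared (R : realType) (n1 n2 S : nat) (K0 : set 'cV[R]_n1)
    (K : 'I_S -> set 'cV[R]_n2) : CPS K0 K `<=` @shared_block_tuples R n1 n2 S.
Proof.
move=> M [X [Z [Y [-> [W [hW hX]]]]]].
have hs i : (W i)^T = W i /\ (Y i)^T = Y i.
  by have /CPP_sym := hW i; rewrite tr_block_mx trmxK => /eq_block_mx[-> _ _ ->].
split; last by exists X => i; rewrite ffunE block_mxKul.
move=> i; rewrite ffunE tr_block_mx trmxK (hs i).2 -hX raddf_sum /=.
by congr (block_mx _ _ _ _); apply: eq_bigr => j _; rewrite (hs j).1.
Qed.

Lemma CMP_shared (R : realType) (n1 n2 S : nat) (K0 : set 'cV[R]_n1)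
    (K : 'I_S -> set 'cV[R]_n2) : CMP K0 K `<=` @shared_block_tuples R n1 n2 S.
Proof.
apply: smallest_sub.
  apply/convex_setW => M N; rewrite !inE => -[sM [X hX]] [sN [X' hX']] t _ _.
  have E i : conv t M N i = t%:num *: M i + (1 - t%:num) *: N i.
    by rewrite /conv /= ffunE; congr (_ + _); rewrite ffunE.
  rewrite inE; split=> [i|]; first by rewrite E [LHS]raddfD /= !linearZ /= sM sN.
  exists (t%:num *: X + (1 - t%:num) *: X') => i.
  by rewrite E -(hX i) -(hX' i); apply/matrixP => a b; rewrite !mxE.
move=> M [x [y [_ _ ->]]]; split=> [i|]; first by rewrite ffunE trmx_mul trmxK.
exists (x *m x^T) => i.
by rewrite ffunE tr_col_mx mul_col_row block_mxKul.
Qed.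

(* Main.v *)
(* A vector (x, y) of K_0 x K_j contributes (x, y)(x, y)^T to the j-th matrix of
   the CPS decomposition, and x x^T to the common block X. Since all K_i contain
   the origin, this is the generator of CMP with y_j = y and y_i = 0 for i <> j.
   It remains to sum: the generators of CMP are stable under nonnegative scaling,
   so their convex hull is a convex cone, hence stable under addition. *)
Require Import Defs.
From mathcomp Require Import all_boot all_order all_algebra.
From mathcomp Require Import all_classical all_reals all_analysis.
Set Implicit Arguments.
Unset Strict Implicit.
Unset Printing Implicit Defensive.
Import Order.TTheory GRing.Theory Num.Theory.
Import numFieldNormedType.Exports.
Local Open Scope classical_set_scope.
Local Open Scope ring_scope.

(** For any [x] in [K], the points [x / (n + 1)] stay in [K] and tend to the origin. *)
Lemma closed_cone0 (R : realType) (m : nat) (K : set 'cV[R]_m) :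
  closed K -> cone K -> K 0.
Proof.
move=> Kcl [[x Kx] Ksc].
have -> : (0 : 'cV[R]_m) = 0 *: x by rewrite scale0r.
apply: (@closed_cvg _ _ \oo _ (fun n => @harmonic R n *: x) K) => //.
  by apply: nearW => n; apply: Ksc => //; rewrite invr_gt0 ltr0n.
by apply: cvgZr_tmp; exact: cvg_harmonic.
Qed.

Section ConvHull.
Variables (R : realType) (V : lmodType R).
Implicit Types (A : set V) (u v : V).

Lemma sub_conv_hull A : A `<=` conv_hull A.
Proof. exact: sub_smallest. Qed.

Lemma conv_hull_conv A u v (t : {i01 R}) :
  conv_hull A u -> conv_hull A v ->
  conv_hull A (t%:num *: u + (1 - t%:num) *: v).
Proof.
move=> Au Av C [Ccvx AC].
have := Ccvx (u : convex_lmodType V) (v : convex_lmodType V) t.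
by rewrite !inE; apply; [apply: Au | apply: Av].
Qed.

(** Scaling is linear, so the vectors that [s] sends into the hull form a convex set; this set
    contains [A], hence the whole hull. *)
Lemma conv_hullZ A (s : R) u :
  (forall v, A v -> A (s *: v)) -> conv_hull A u -> conv_hull A (s *: u).
Proof.
move=> As; move: u; apply: smallest_sub => [u v t|v Av].
  rewrite !inE => Au Av /=.
  have := conv_hull_conv t Au Av.
  by rewrite !scalerA !(mulrC _ s) -!scalerA -scalerDr.
by apply: sub_conv_hull; exact: As.
Qed.

(** The sum is twice the midpoint of [u] and [v], so stability of [A] under doubling suffices. *)
Lemma conv_hullD A u v : (forall w, A w -> A (2 *: w)) ->
  conv_hull A u -> conv_hull A v -> conv_hull A (u + v).
Proof.
move=> A2 Au Av.
have h0 : (0 : R) <= 2^-1 by rewrite invr_ge0 ler0n.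
have h1 : (2^-1 : R) <= 1 by rewrite invf_le1 ?ltr0n // ler1n.
have := conv_hullZ A2 (conv_hull_conv (Itv01 h0 h1) Au Av).
have -> : 1 - (Itv01 h0 h1)%:num = 2^-1 :> R.
  by rewrite [X in X - _]splitr mul1r addrK.
by rewrite -scalerDr scalerA divff ?scale1r // pnatr_eq0.
Qed.

End ConvHull.

Section CMP.
Variables (R : realType) (n1 n2 S : nat).
Variables (K0 : set 'cV[R]_n1) (K : 'I_S -> set 'cV[R]_n2).
Hypotheses (cK0 : cone K0) (K00 : K0 0).
Hypotheses (cK : forall i, cone (K i)) (K_0 : forall i, K i 0).

Lemma CMP_generator (x : 'cV[R]_n1) (y : 'I_S -> 'cV[R]_n2) :
  K0 x -> (forall i, K i (y i)) ->
  CMP K0 K [ffun i => col_mx x (y i) *m (col_mx x (y i))^T].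
Proof. by move=> K0x Ky; apply: sub_conv_hull; exists x, y. Qed.

Lemma CMP0 : CMP K0 K 0.
Proof.
have := CMP_generator K00 K_0; congr (CMP _ _ _).
by apply/ffunP => i; rewrite !ffunE col_mx0 mul0mx.
Qed.

Lemma CMPD M N : CMP K0 K M -> CMP K0 K N -> CMP K0 K (M + N).
Proof.
apply: conv_hullD => _ [x [y [K0x Ky ->]]].
(* Generators are quadratic in [(x, y)]: scaling the vectors by the square root of 2 doubles the
   generator. *)
have s_gt0 : 0 < Num.sqrt 2 :> R by rewrite sqrtr_gt0 ltr0n.
exists (Num.sqrt 2 *: x), (fun i => Num.sqrt 2 *: y i).
split=> [|i|]; [exact: cK0.2 | exact: (cK i).2 |].
apply/ffunP => i; rewrite !ffunE -scale_col_mx linearZ /= -scalemxAl -scalemxAr.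
by rewrite scalerA -expr2 sqr_sqrtr ?ler0n.
Qed.

Lemma CMP_sum (I : finType) (M : I -> {ffun 'I_S -> 'M[R]_(n1 + n2)}) :
  (forall i, CMP K0 K (M i)) -> CMP K0 K (\sum_i M i).
Proof. by move=> KM; apply: big_ind => //; [exact: CMP0 | exact: CMPD]. Qed.

(** For [N = (x, y)(x, y)^T] this is the generator with [y] in position [j] and 0 elsewhere. Phrased
    through the blocks of [N], it is additive in [N], so sums of rank-one terms can be treated
    termwise. *)
Definition pad_tuple (j : 'I_S) (N : 'M[R]_(n1 + n2)) :
    {ffun 'I_S -> 'M[R]_(n1 + n2)} :=
  [ffun i => if i == j then N else block_mx (ulsubmx N) 0 0 0].

Lemma pad_tuple_sum (j : 'I_S) (I : finType) (N : I -> 'M[R]_(n1 + n2)) :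
  pad_tuple j (\sum_l N l) = \sum_l pad_tuple j (N l).
Proof.
apply: (big_morph (pad_tuple j)) => [M N'|]; apply/ffunP => i; rewrite !ffunE.
  by case: ifP => // _; rewrite add_block_mx !addr0 /ulsubmx !linearD.
by case: ifP => // _; rewrite /ulsubmx !linear0 block_mx0.
Qed.

Lemma CMP_pad_tuple (j : 'I_S) (N : 'M[R]_(n1 + n2)) :
  CPP (cone_prod K0 (K j)) N -> CMP K0 K (pad_tuple j N).
Proof.
move=> [p [z [Kz ->]]]; rewrite pad_tuple_sum; apply: CMP_sum => l.
have [x K0x [y Ky <-]] := Kz l.
(* The zero padding is admissible because every [K i] contains the origin. *)
have Ky' i : K i (if i == j then y else 0) by case: eqP => [->|_].
have := CMP_generator K0x Ky'; congr (CMP _ _ _).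
apply/ffunP => i; rewrite !ffunE; case: eqP => // _.
by rewrite !tr_col_mx !mul_col_row block_mxKul trmx0 !mulmx0 !mul0mx.
Qed.

End CMP.

Theorem theorem11 (R : realType) (n1 n2 S : nat)
    (K0 : set 'cV[R]_n1) (K : 'I_S -> set 'cV[R]_n2)
    (hK0 : closed_convex_cone K0)
    (hK : forall i, closed_convex_cone (K i))
    (hK_origin : forall i, K i 0) :
  CPS K0 K `<=` CMP K0 K.
Proof.
move=> M [X [Z [Y [-> [W [hW hX]]]]]].
have [K0cl _ cK0] := hK0.
have cK i : cone (K i) by have [] := hK i.
have K00 := closed_cone0 K0cl cK0.
pose N j := block_mx (W j) (Z j)^T (Z j) (Y j).
(* In component [i], the term [j = i] supplies [W i] together with the blocks [Z i] and [Y i]; every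
   other term adds only [W j] to the upper-left block, which thus sums to [X]. *)
have -> : [ffun i => block_mx X (Z i)^T (Z i) (Y i)] = \sum_j pad_tuple j (N j).
  apply/ffunP => i; rewrite sum_ffunE ffunE (bigD1 i) //= ffunE eqxx.
  under eq_bigr => j ji do rewrite ffunE eq_sym (negPf ji) block_mxKul.
  have -> : \sum_(j | j != i) block_mx (W j) 0 0 0 =
            block_mx (\sum_(j | j != i) W j) 0 0 0 :> 'M[R]_(n1 + n2).
    symmetry; apply: (big_morph (fun A => block_mx A 0 0 0)) => [A B|].
      by rewrite add_block_mx !addr0.
    by rewrite block_mx0.
  by rewrite add_block_mx !addr0 -hX [in LHS](bigD1 i).
by apply: CMP_sum => // j; exact: CMP_pad_tuple.
Qed.
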